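(* Let $\Sigma\in\mathbb{S}^d$ be a positive semidefinite sample correlation matrix (all diagonal entries equal to $1$, off-diagonal entries in $(-1,1)$), let $\lambda>0$, and let $S^{\mathrm{opt}}$ be the optimal solution of the Graphical Lasso $$\min_{S\succ 0}\; -\log\det(S)+\mathrm{trace}(\Sigma S)+\lambda\sum_{i\neq j}|S_{ij}|.$$ Let $\mathcal{G}$ be the graph on $\{1,\ldots,d\}$ with an edge $\{i,j\}$ ($i\ne j$) iff $|\Sigma_{ij}|>\lambda$, and let $C$ be the partial symmetric matrix specified on the pattern $E=\{(i,i)\}\cup\{(i,j):\{i,j\}\in\mathcal{G}\}$ by $C_{ii}=1$ and $C_{ij}=\Sigma_{ij}-\lambda\,\mathrm{sign}(\Sigma_{ij})$ for $\{i,j\}\in\mathcal{G}$. Assume that for all $i\neq j$, $S^{\mathrm{opt}}_{ij}\neq0$ if and only if $|\Sigma_{ij}|>\lambda$, and that $\lambda\geq 0.5$. Then: 1. $(S^{\mathrm{opt}})^{-1}$ is the unique max-det completion of $C$, i.e. the unique optimal solution of $\max\{\log\det X: X\succ0,\ X_{ij}=C_{ij}\text{ for all }(i,j)\in E\}$. 2. If moreover $\mathcal{G}$ is chordal, then, after relabeling the vertices so that $1,2,\ldots,d$ is a perfect elimination ordering of $\mathcal{G}$ and setting $I_j=\{i>j:\{i,j\}\in\mathcal{G}\}$, one has $S^{\mathrm{opt}}=LDL^{T}$, where $L$ is unit lower triangular with $L_{ij}=0$ for $i>j$, $i\notin I_j$, and $L_{I_jj}=-C_{I_jI_j}^{-1}C_{I_jj}$,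 and $D$ is diagonal with $D_{jj}=(C_{jj}+C_{I_jj}^{T}L_{I_jj})^{-1}$ (computed for $j=d,d-1,\ldots,1$).
   Context: A graph is chordal if it has no induced cycle of length greater than three. An ordering $1,\ldots,d$ of the vertices is a perfect elimination ordering if for every $j$ the set $I_j$ of neighbors of $j$ with larger index forms a clique; every chordal graph admits one. For index sets $I,J$, $C_{IJ}$ denotes the submatrix with rows $I$ and columns $J$; all entries of $C_{I_jI_j}$ and $C_{I_jj}$ are specified since $I_j\cup\{j\}$ is a clique. $\mathrm{sign}(x)$ is the sign of the scalar $x$. *)

(* Defs.v *)
From HB Require Import structures.
From mathcomp Require Import all_boot all_order all_algebra fingroup perm.
From mathcomp Require Import reals exp.
Set Implicit Arguments. Unset Strict Implicit. Unset Printing Implicit Defensive.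
Import Order.TTheory GRing.Theory Num.Theory.
Local Open Scope ring_scope.

Section Defs.
Variable R : realType.

Definition psd n (A : 'M[R]_n) : Prop :=
  A^T = A /\ forall x : 'cV[R]_n, 0 <= (x^T *m A *m x) 0 0.
Definition pd n (A : 'M[R]_n) : Prop :=
  A^T = A /\ forall x : 'cV[R]_n, x != 0 -> 0 < (x^T *m A *m x) 0 0.

Definition correlation n (Sigma : 'M[R]_n) : Prop :=
  psd Sigma /\ (forall i, Sigma i i = 1) /\
  (forall i j, i != j -> -1 < Sigma i j < 1).

Definition glasso_obj n (Sigma : 'M[R]_n) (lam : R) (S : 'M[R]_n) : R :=
  - ln (\det S) + \tr (Sigma *m S)
  + lam * \sum_(i < n) \sum_(j < n | i != j) `|S i j|.

Definition glasso_opt n (Sigma : 'M[R]_n) (lam : R) (S : 'M[R]_n) : Prop :=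
  pd S /\ forall S' : 'M[R]_n, pd S' -> glasso_obj Sigma lam S <= glasso_obj Sigma lam S'.

Definition gedge n (Sigma : 'M[R]_n) (lam : R) (i j : 'I_n) : bool :=
  (i != j) && (lam < `|Sigma i j|).

(* entries of the partial matrix C on the pattern E (diagonal and edges);
   entries outside E are unspecified and set to 0 here (never used). *)
Definition Cmat n (Sigma : 'M[R]_n) (lam : R) : 'M[R]_n :=
  \matrix_(i, j) if i == j then 1
                 else if gedge Sigma lam i j
                      then Sigma i j - lam * Num.sg (Sigma i j) else 0.

Definition in_pattern n (Sigma : 'M[R]_n) (lam : R) (i j : 'I_n) : bool :=
  (i == j) || gedge Sigma lam i j.

Definition completion n (Sigma : 'M[R]_n) (lam : R) (X : 'M[R]_n) : Prop :=
  forall i j, in_pattern Sigma lam i j -> X i j = Cmat Sigma lam i j.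

Definition unique_maxdet_completion n (Sigma : 'M[R]_n) (lam : R) (X : 'M[R]_n) : Prop :=
  pd X /\ completion Sigma lam X /\
  forall Y : 'M[R]_n, pd Y -> completion Sigma lam Y -> Y != X ->
    ln (\det Y) < ln (\det X).

(* chordal: no induced cycle of length > 3.  An induced cycle is a list
   c = v_0..v_(k-1) of k >= 4 distinct vertices such that v_a, v_b are
   adjacent iff a, b are cyclically consecutive. (v is the first vertex,
   used also as the irrelevant default of nth.) *)
Definition induced_cycle n (e : rel 'I_n) (v : 'I_n) (s : seq 'I_n) : Prop :=
  let c := v :: s in
  uniq c /\
  forall a b, (a < size c)%N -> (b < size c)%N ->
    e (nth v c a) (nth v c b) =
    ((b == a.+1 %% size c) || (a == b.+1 %% size c))%N.

Definition chordal n (e : rel 'I_n) : Prop :=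
  forall v s, (3 <= size s)%N -> ~ induced_cycle e v s.

(* relabeled graph/matrices: new vertex k is old vertex p k *)
Definition relabel n (p : 'S_n) (A : 'M[R]_n) : 'M[R]_n :=
  \matrix_(i, j) A (p i) (p j).

Definition Iset n (e : rel 'I_n) (j : 'I_n) : {set 'I_n} :=
  [set i : 'I_n | (j < i)%N && e i j].

Definition peo n (e : rel 'I_n) : Prop :=
  forall j a b, a \in Iset e j -> b \in Iset e j -> a != b -> e a b.

Definition Lcol n (e : rel 'I_n) (C : 'M[R]_n) (j : 'I_n) : 'cV[R]_#|Iset e j| :=
  let CII := \matrix_(a, b) C (enum_val a) (enum_val b) : 'M[R]_#|Iset e j| in
  let CIj := \col_a C (enum_val a) j : 'cV[R]_#|Iset e j| in
  - (invmx CII *m CIj).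

Definition Lmat n (e : rel 'I_n) (C : 'M[R]_n) : 'M[R]_n :=
  \matrix_(i, j) if i == j then 1
                 else \sum_(a < #|Iset e j| | enum_val a == i) Lcol e C j a 0.

Definition Dmat n (e : rel 'I_n) (C : 'M[R]_n) : 'M[R]_n :=
  \matrix_(i, j) if i == j then
     (C j j + \sum_(a < #|Iset e j|) C (enum_val a) j * Lcol e C j a 0)^-1
   else 0.

End Defs.

(* Main.v *)
Require Import Defs.
From HB Require Import structures.
From mathcomp Require Import all_boot all_order all_algebra fingroup perm.
From mathcomp Require Import reals exp.
From mathcomp Require Import sequences ring lra.
Set Implicit Arguments. Unset Strict Implicit. Unset Printing Implicit Defensive.
Import Order.TTheory GRing.Theory Num.Theory.
Local Open Scope ring_scope.

(** Let [W] be the inverse of the optimum [S].  Perturbing [S] by [t u u^T] with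
    [u = e_k] and [u = e_k + e_l] gives the stationarity conditions
    [W_kk = Sigma_kk = 1] and [W_kl = Sigma_kl + lam sgn S_kl] where [S_kl] is
    nonzero; these rank-one directions are convenient because
    [det (S + t u u^T) = det S * (1 + t u^T W u)].  Were [S_kl] and [Sigma_kl] of
    the same sign, then [|W_kl| = |Sigma_kl| + lam > 2 lam >= 1], which is
    impossible for a positive definite [W] with unit diagonal; so [W] completes
    [C].  Any completion [Y] has [tr (S Y) = tr (S W) = d] because [S] vanishes
    off the pattern, and then [det (S Y) < 1] unless [Y = W].  Finally, along a
    perfect elimination ordering [S] has an LDL^T factorization without fill-in,
    and [W L D] is the inverse of [L^T], hence unit upper triangular; reading
    off the entries on and below the diagonal yields the formulas. *)

(** * Positive definite matrices: congruence, inverses, principal submatrices, Schur complements *)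

Section PositiveDefinite.
Variable R : realType.

Lemma pd_congr m n (A : 'M[R]_n) (P : 'M[R]_(n, m)) :
  pd A -> (forall x : 'cV_m, P *m x = 0 -> x = 0) -> pd (P^T *m A *m P).
Proof.
move=> [Asym Apos] Pinj; split; first by rewrite !trmx_mul trmxK Asym mulmxA.
move=> x x0.
have -> : x^T *m (P^T *m A *m P) *m x = (P *m x)^T *m A *m (P *m x).
  by rewrite trmx_mul !mulmxA.
by apply: Apos; apply: contra_neq x0 => /Pinj.
Qed.

Lemma pd_unitmx n (A : 'M[R]_n) : pd A -> A \in unitmx.
Proof.
move=> [Asym Apos]; rewrite -row_free_unit -kermx_eq0.
apply/eqP/row_matrixP => i; rewrite row0; apply/eqP/negP => /negP ri0.
have := Apos (row i (kermx A))^T; rewrite trmx_eq0 => /(_ ri0).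
by rewrite trmxK -row_mul mulmx_ker row0 mul0mx mxE ltxx.
Qed.

Lemma pd_congr_unit n (A P : 'M[R]_n) :
  pd A -> P \in unitmx -> pd (P^T *m A *m P).
Proof.
move=> Apd uP; apply: pd_congr => // x Px.
by rewrite -[x](mulKmx uP) Px mulmx0.
Qed.

Lemma pd_inv n (A : 'M[R]_n) : pd A -> pd (invmx A).
Proof.
move=> Apd; have uA := pd_unitmx Apd.
have -> : invmx A = (invmx A)^T *m A *m invmx A.
  by rewrite mulmxK // trmx_inv (proj1 Apd).
by apply: pd_congr_unit; rewrite // unitmx_inv.
Qed.

Lemma pd_mxsub m n (A : 'M[R]_n) (f : 'I_m -> 'I_n) :
  injective f -> pd A -> pd (mxsub f f A).
Proof.
move=> finj Apd.
have -> : mxsub f f A = (colsub f 1%:M)^T *m A *m colsub f 1%:M.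
  rewrite trmx_mxsub trmx1 mul_rowsub_mx mul1mx -mxsub_mul.
  by apply/matrixP => i j; rewrite mulmx1 !mxE.
apply: pd_congr => // x /(congr1 (mulmx (rowsub f 1%:M))).
rewrite mulmx0 mulmxA mul_rowsub_mx mul1mx => <-.
suff -> : rowsub f (colsub f 1%:M) = 1%:M :> 'M[R]_m by rewrite mul1mx.
by apply/matrixP => i j; rewrite !mxE (inj_eq finj).
Qed.

Lemma pd_diag_gt0 n (A : 'M[R]_n) i : pd A -> 0 < A i i.
Proof.
move=> [_ /(_ (delta_mx i 0))]; rewrite trmx_delta -rowE -colE !mxE; apply.
by apply/eqP => /matrixP/(_ i 0)/eqP; rewrite !mxE !eqxx oner_eq0.
Qed.

(** The Schur complement is the congruence of the block matrix by [Q], which is injective because of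
    its lower identity block. *)
Lemma pd_congr_schur n (a : R) (b : 'cV[R]_n) (B : 'M[R]_n) :
  pd (block_mx a%:M b^T b B : 'M_(1 + n)) -> pd (B - a^-1 *: (b *m b^T)).
Proof.
move=> Apd; have a0 : a != 0.
  have /lt0r_neq0 := pd_diag_gt0 (lshift n 0) Apd.
  by rewrite block_mxEul mxE.
pose Q : 'M[R]_(1 + n, n) := col_mx (- (a^-1 *: b^T)) 1%:M.
have -> : B - a^-1 *: (b *m b^T) = Q^T *m block_mx a%:M b^T b B *m Q.
  rewrite /Q tr_col_mx mul_row_block mul_row_col !mulmx1 trmx1 !mul1mx.
  have -> : (- (a^-1 *: b^T))^T = - (a^-1 *: b).
    by apply/matrixP => i j; rewrite !mxE.
  rewrite mulNmx mul_mx_scalar scalerA mulfV //.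
  by rewrite scale1r addNr mul0mx add0r mulNmx -scalemxAl addrC.
apply: pd_congr => // x; rewrite mul_col_mx mul1mx => /eqP.
by rewrite col_mx_eq0 => /andP[_ /eqP].
Qed.

(** * Triangular factorization without fill-in *)

Definition unit_lower n (L : 'M[R]_n) : Prop :=
  (forall i, L i i = 1) /\ forall i j : 'I_n, (i < j)%N -> L i j = 0.

Lemma det_unit_lower n (L : 'M[R]_n) : unit_lower L -> \det L = 1.
Proof.
move=> [L1 L0]; rewrite det_trig; last by apply/is_trig_mxP.
by apply: big1 => i _.
Qed.

(** Induction eliminates the first vertex. Passing to the Schur complement changes an entry only if
    both indices are neighbors of that vertex; these form a clique, so zeros off the pattern
    survive. *)
Lemma pd_ldl_sparse n (e : rel 'I_n) (A : 'M[R]_n) :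
  pd A -> peo e -> (forall i j, i != j -> ~~ e i j -> A i j = 0) ->
  exists L : 'M[R]_n, exists c : 'rV[R]_n,
  [/\ unit_lower L, forall i j : 'I_n, (j < i)%N -> ~~ e i j -> L i j = 0,
      forall i, 0 < c 0 i & A = L *m diag_mx c *m L^T].
Proof.
elim: n e A => [|n IH] e A Apd pe A0.
  by exists 1%:M, 0; split; [split; case|case|case|apply/matrixP; case].
have Asym := proj1 Apd.
pose a := A 0 0; pose b : 'cV[R]_n := \col_i A (rshift 1 i) 0.
pose B : 'M[R]_n := \matrix_(i, j) A (rshift 1 i) (rshift 1 j).
have l0 (k : 'I_1) : lshift n k = 0 by rewrite ord1; apply: val_inj.
have AE : A = block_mx a%:M b^T b B :> 'M_(1 + n).
  apply/matrixP => i j.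
  case: (@split_ordP 1 n i) => i' ->; case: (@split_ordP 1 n j) => j' ->.
  - by rewrite block_mxEul !l0 !mxE !ord1 eqxx.
  - by rewrite block_mxEur l0 !mxE -[in RHS]Asym mxE.
  - by rewrite block_mxEdl l0 !mxE.
  - by rewrite block_mxEdr !mxE.
have a_gt0 : 0 < a by apply: pd_diag_gt0.
have Bpd : pd (B - a^-1 *: (b *m b^T)) by apply: pd_congr_schur; rewrite -AE.
pose e' : rel 'I_n := fun i j => e (rshift 1 i) (rshift 1 j).
have pe' : peo e'.
  move=> j x y; rewrite !inE => xj yj xy.
  by apply: (pe (rshift 1 j)); rewrite ?inE //; rewrite (inj_eq (@rshift_inj _ _)).
have b0 i : ~~ e (rshift 1 i) 0 -> b i 0 = 0.
  by move=> ne; rewrite mxE; apply: A0.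
case: (IH e' _ Bpd pe') => [i j ij ne|L [c [[L1 L0] Ls cp BE]]].
  have ij' : rshift 1 i != rshift 1 j by rewrite (inj_eq (@rshift_inj _ _)).
  rewrite 2!mxE (A0 _ _ ij' ne) add0r !mxE big_ord1 !mxE.
  case: (boolP (e (rshift 1 i) 0)) => ei; last first.
    by have := b0 _ ei; rewrite mxE => ->; rewrite mul0r mulr0 oppr0.
  case: (boolP (e (rshift 1 j) 0)) => ej; last first.
    by have := b0 _ ej; rewrite mxE => ->; rewrite mulr0 mulr0 oppr0.
  have I0 k : e (rshift 1 k) 0 -> rshift 1 k \in Iset e 0.
    by move=> ek; rewrite inE; exact: ek.
  by case/negP: ne; apply: (pe 0 _ _ (I0 i ei) (I0 j ej)).
(* The size is restated as [1 + n], the shape that block matrices need. *)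
suff [M [w P]] : exists (L : 'M[R]_(1 + n)) (c : 'rV[R]_(1 + n)),
  [/\ unit_lower L,
      forall i j : 'I_(1 + n), (j < i)%N -> ~~ e i j -> L i j = 0,
      forall i : 'I_(1 + n), 0 < c 0 i & A = L *m diag_mx c *m L^T]; first by exists M, w.
(* The new column is the eliminated one divided by its pivot [a]; the other pivots are those of the
   Schur complement. *)
exists (block_mx 1%:M 0 (a^-1 *: b) L), (row_mx a%:M c).
split.
- split=> [i|i j].
    case: (@split_ordP 1 n i) => i' ->.
      by rewrite block_mxEul mxE eqxx.
    by rewrite block_mxEdr L1.
  case: (@split_ordP 1 n i) => i' ->; case: (@split_ordP 1 n j) => j' ->.
  - by rewrite !ord1.
  - by rewrite block_mxEur mxE.
  - by rewrite ord1.
  - by rewrite block_mxEdr ltn_add2l; apply: L0.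
- move=> i j.
  case: (@split_ordP 1 n i) => i' ->; case: (@split_ordP 1 n j) => j' ->.
  - by rewrite !ord1.
  - by rewrite !ord1.
  - by rewrite block_mxEdl l0 => _ /b0 bi; rewrite mxE ord1 bi mulr0.
  - by rewrite block_mxEdr ltn_add2l; apply: Ls.
- move=> i; case: (@split_ordP 1 n i) => i' ->.
    by rewrite row_mxEl mxE ord1 eqxx.
  by rewrite row_mxEr.
- rewrite [LHS]AE diag_mx_row tr_block_mx !mulmx_block.
  rewrite !(mulmx0, mul0mx, mul1mx, mulmx1, trmx0, trmx1, addr0, add0r) -BE.
  have -> : diag_mx a%:M = a%:M :> 'M[R]_1.
    by apply/matrixP => i j; rewrite !mxE !ord1 eqxx.
  rewrite !mul_mx_scalar !mul_scalar_mx scalerA mulfV ?gt_eqF // scale1r.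
  have -> : (a^-1 *: b)^T = a^-1 *: b^T by apply/matrixP => i j; rewrite !mxE.
  rewrite scalerA mulfV ?gt_eqF // scale1r -scalemxAr.
  by rewrite addrC subrK.
Qed.

(** In the complete graph every ordering is a perfect elimination ordering and no zeros are
    prescribed. *)
Lemma pd_ldl n (A : 'M[R]_n) : pd A ->
  exists L : 'M[R]_n, exists c : 'rV[R]_n,
  [/\ unit_lower L, forall i, 0 < c 0 i & A = L *m diag_mx c *m L^T].
Proof.
move=> Apd; have [|||L [c [? _ ? ?]]] := @pd_ldl_sparse n (fun _ _ => true) A => //.
by exists L, c.
Qed.

(** * A strict log-determinant inequality at fixed trace *)

Lemma ln_le_sub1 (x : R) : 0 < x -> ln x <= x - 1.
Proof.
move=> x0; have := @le_ln1Dx R (x - 1).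
by rewrite [1 + _]addrC subrK; apply; lra.
Qed.

Lemma ln_lt_sub1 (x : R) : 0 < x -> x != 1 -> ln x < x - 1.
Proof.
move=> x0 x1; rewrite -ltr_expR lnK ?posrE //.
by have := @expR_gt1Dx R (x - 1); rewrite [1 + _]addrC subrK subr_eq0; apply.
Qed.

(* With [S = L C L^T] and [L^T Y L = N G N^T], the trace of [S Y] is
   [sum_ij C_i N_ij^2 G_j], its diagonal terms are [C_i G_i], and
   [det (S Y)] is the product of the [C_i G_i]. *)
Lemma pd_det_lt n (S Y : 'M[R]_n) :
  pd S -> pd Y -> \tr (S *m Y) = n%:R -> S *m Y != 1%:M ->
  ln (\det S) + ln (\det Y) < 0.
Proof.
move=> Spd Ypd trSY SY1.
have [L [c [uL cp SE]]] := pd_ldl Spd.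
have uLm : L \in unitmx by rewrite unitmxE det_unit_lower ?unitr1.
have [N [g [uN gp ZE]]] := pd_ldl (pd_congr_unit Ypd uLm).
have detS : \det S = \prod_i c 0 i.
  by rewrite SE !det_mulmx det_tr (det_unit_lower uL) mul1r mulr1 det_diag.
have detY : \det Y = \prod_i g 0 i.
  have := congr1 determinant ZE.
  rewrite !det_mulmx !det_tr (det_unit_lower uL) (det_unit_lower uN).
  by rewrite !mul1r !mulr1 det_diag.
have ln_prod (u : 'rV[R]_n) : (forall i, 0 < u 0 i) ->
    ln (\prod_i u 0 i) = \sum_i ln (u 0 i).
  move=> up; suff [] : 0 < \prod_i u 0 i /\ ln (\prod_i u 0 i) = \sum_i ln (u 0 i) by [].
  elim/big_rec2: _ => [|i y z _ [z0 <-]]; first by rewrite ltr01 ln1.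
  by rewrite mulr_gt0 // lnM ?posrE.
pose t i j := c 0 i * (N i j ^+ 2 * g 0 j).
have trE : \tr (S *m Y) = \sum_i \sum_j t i j.
  have -> : \tr (S *m Y) = \tr (diag_mx c *m (N *m diag_mx g *m N^T)).
    by rewrite -ZE SE -!mulmxA mxtrace_mulC -!mulmxA.
  apply: eq_bigr => i _; rewrite mul_diag_mx !mxE mulr_sumr; apply: eq_bigr => j _.
  by rewrite mul_mx_diag !mxE /t; congr (_ * _); rewrite expr2 mulrAC.
have t_ge0 i j : 0 <= t i j.
  exact: mulr_ge0 (ltW (cp i)) (mulr_ge0 (sqr_ge0 _) (ltW (gp j))).
have tii i : t i i = c 0 i * g 0 i by rewrite /t (proj1 uN) expr1n mul1r.
have tii_gt0 i : 0 < t i i by rewrite tii mulr_gt0.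
have row_ge i : ln (t i i) <= \sum_j t i j - 1.
  rewrite (bigD1 i) //= addrAC (le_trans (ln_le_sub1 (tii_gt0 i))) //.
  by rewrite lerDl sumr_ge0.
rewrite detS detY !ln_prod // -big_split /=.
have -> : \sum_i (ln (c 0 i) + ln (g 0 i)) = \sum_i ln (t i i).
  by apply: eq_bigr => i _; rewrite tii lnM ?posrE.
have sum0 : \sum_i (\sum_j t i j - 1) = 0.
  by rewrite sumrB -trE trSY sumr_const card_ord subrr.
(* The row bounds sum to 0. If the sum of logarithms were not smaller, every row bound would be an
   equality: off-diagonal [t i j] vanish and [t i i = 1], so [N = 1%:M] and [S *m Y = 1%:M]. *)
rewrite -[ltRHS]sum0 ltNge; apply/negP => le_sum; case/negP: SY1; apply/eqP.
have row_eq i : ln (t i i) = \sum_j t i j - 1.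
  apply/eqP; rewrite eq_le row_ge leNgt; apply/negP => lt_i.
  move: le_sum; rewrite leNgt => /negP; apply.
  rewrite (bigD1 i) //= [ltRHS](bigD1 i) //=; apply: ltr_leD => //.
  by apply: ler_sum => k _; apply: row_ge.
have off0 i j : j != i -> t i j = 0.
  move=> ji; apply/eqP; rewrite eq_le t_ge0 andbT.
  have := ln_le_sub1 (tii_gt0 i); rewrite row_eq (bigD1 i) //= (bigD1 j) //=.
  have : 0 <= \sum_(k < n | (k != i) && (k != j)) t i k by rewrite sumr_ge0.
  lra.
have tii1 i : t i i = 1.
  apply/eqP/negPn/negP => /(ln_lt_sub1 (tii_gt0 i)).
  by rewrite row_eq (bigD1 i) //= big1 ?addr0 ?ltxx // => j; apply: off0.
have N1 : N = 1%:M.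
  apply/matrixP => i j; rewrite mxE; case: eqVneq => [->|ij]; first exact: (proj1 uN).
  have := off0 i j; rewrite eq_sym ij => /(_ isT)/eqP.
  by rewrite /t !mulf_eq0 ![_ 0 _ == 0]gt_eqF //= orbF orbb => /eqP.
have CZ : diag_mx c *m (L^T *m Y *m L) = 1%:M.
  rewrite ZE N1 mul1mx trmx1 mulmx1 mul_diag_mx; apply/matrixP => i j.
  rewrite !mxE; case: eqVneq => [->|]; last by rewrite mulr0.
  by rewrite !mulr1n -tii tii1.
rewrite -[LHS](mulmxK uLm).
have -> : S *m Y *m L = L *m (diag_mx c *m (L^T *m Y *m L)) by rewrite SE !mulmxA.
by rewrite CZ mulmx1 mulmxV.
Qed.

End PositiveDefinite.

(** * Rank-one perturbations: positivity and determinant *)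

Section RankOne.
Variable R : realType.

Lemma pd_det_gt0 n (A : 'M[R]_n) : pd A -> 0 < \det A.
Proof.
move=> /pd_ldl[L [c [uL cp ->]]].
rewrite !det_mulmx det_tr (det_unit_lower uL) mul1r mulr1 det_diag.
exact: prodr_gt0.
Qed.

(** One block matrix is factored in two ways, eliminating either diagonal block, and the
    determinants are compared. *)
Lemma det_add1_rank1 n (u : 'cV[R]_n) (v : 'rV[R]_n) :
  \det (1%:M + u *m v) = 1 + (v *m u) 0 0.
Proof.
have E1 : block_mx 1%:M (- v) u 1%:M
        = block_mx 1%:M 0 u 1%:M *m block_mx 1%:M (- v) 0 (1%:M + u *m v).
  rewrite mulmx_block !(mulmx0, mul0mx, mul1mx, mulmx1, addr0, add0r).
  by rewrite mulmxN addrCA addNr addr0.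
have E2 : block_mx 1%:M (- v) u 1%:M
        = block_mx 1%:M (- v) 0 1%:M *m block_mx (1%:M + v *m u) 0 u 1%:M.
  rewrite mulmx_block !(mulmx0, mul0mx, mul1mx, mulmx1, addr0, add0r).
  by rewrite mulNmx addrK.
have := congr1 determinant E1; rewrite E2 !det_mulmx !det_ublock !det_lblock.
by rewrite !det1 !(mul1r, mulr1) det_mx11 !mxE => <-; rewrite eqxx.
Qed.

Lemma quad_formB n (A : 'M[R]_n) (a b : R) (x y : 'cV[R]_n) : A^T = A ->
  ((a *: x - b *: y)^T *m A *m (a *: x - b *: y)) 0 0
  = a ^+ 2 * (x^T *m A *m x) 0 0 - 2 * a * b * (y^T *m A *m x) 0 0
    + b ^+ 2 * (y^T *m A *m y) 0 0.
Proof.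
move=> Asym.
have -> : (a *: x - b *: y)^T = a *: x^T - b *: y^T.
  by apply/matrixP => i j; rewrite !mxE.
rewrite !(mulmxBl, mulmxBr) -!scalemxAl -!scalemxAr.
have xy : (x^T *m A *m y) 0 0 = (y^T *m A *m x) 0 0.
  rewrite -[in RHS](trmxK (y^T *m A *m x)) [RHS]mxE.
  by rewrite !trmx_mul trmxK Asym mulmxA.
set p := x^T *m A *m x; set q := x^T *m A *m y in xy *.
set r := y^T *m A *m x in xy *; set s := y^T *m A *m y.
by clearbody p q r s; rewrite !mxE xy; ring.
Qed.

Lemma quad_rank1 n (u x : 'cV[R]_n) (t : R) :
  (x^T *m (t *: (u *m u^T)) *m x) 0 0 = t * ((u^T *m x) 0 0) ^+ 2.
Proof.
have -> : x^T *m (t *: (u *m u^T)) *m x = t *: ((u^T *m x)^T *m (u^T *m x)).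
  by rewrite trmx_mul trmxK -scalemxAr -scalemxAl !mulmxA.
by rewrite [LHS]mxE; congr (_ * _); rewrite mxE big_ord1 mxE expr2.
Qed.

Lemma pd_quad_ge0 n (A : 'M[R]_n) (x : 'cV[R]_n) :
  pd A -> 0 <= (x^T *m A *m x) 0 0.
Proof.
move=> [_ Apos]; have [->|/Apos/ltW//] := eqVneq x 0.
by rewrite mulmx0 mxE.
Qed.

(** With [w], [z] and [q] as in the proof, the form of [S] at [w *: x - z *: (invmx S *m u)] equals
    [w * (w * q - z ^+ 2)]. *)
Lemma pd_cauchy_schwarz n (S : 'M[R]_n) (u x : 'cV[R]_n) : pd S ->
  ((u^T *m x) 0 0) ^+ 2 <= (u^T *m invmx S *m u) 0 0 * (x^T *m S *m x) 0 0.
Proof.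
move=> Spd; have [->|u0] := eqVneq u 0.
  by rewrite trmx0 !mul0mx !mxE expr0n mul0r.
have uS := pd_unitmx Spd.
set w := (u^T *m invmx S *m u) 0 0; set z := (u^T *m x) 0 0.
have w_gt0 : 0 < w by apply: (proj2 (pd_inv Spd)).
have := pd_quad_ge0 (w *: x - z *: (invmx S *m u)) Spd.
rewrite (quad_formB _ _ _ _ (proj1 Spd)) trmx_mul trmx_inv (proj1 Spd).
rewrite mulmxKV // -/z mulmxA -/w.
set q := (_ *m x) 0 0 => h.
have : 0 <= w * (w * q - z ^+ 2).
  by rewrite (le_trans h) // le_eqVlt; apply/orP; left; apply/eqP; ring.
by rewrite pmulr_rge0 // subr_ge0.
Qed.

(** By Cauchy-Schwarz the perturbation changes [q = x^T S x] by at most [|t| * w * q], which is less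
    than [q]. *)
Lemma pd_add_rank1 n (S : 'M[R]_n) (u : 'cV[R]_n) (t : R) : pd S ->
  `|t| * (u^T *m invmx S *m u) 0 0 < 1 -> pd (S + t *: (u *m u^T)).
Proof.
move=> Spd; set w := (_ *m u) 0 0 => tw; split.
  have -> : (S + t *: (u *m u^T))^T = S^T + t *: (u *m u^T)^T.
    by apply/matrixP => i j; rewrite !mxE.
  by rewrite trmx_mul trmxK (proj1 Spd).
move=> x x0; rewrite mulmxDr mulmxDl mxE quad_rank1.
have := pd_cauchy_schwarz u x Spd; rewrite -/w.
have := proj2 Spd x x0.
set q := (_ *m x) 0 0; set z := (u^T *m x) 0 0 => q0 zq.
have w0 : 0 <= w by apply: pd_quad_ge0; apply: pd_inv.
have h1 : `|t| * z ^+ 2 <= `|t| * (w * q) by rewrite ler_wpM2l.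
have h2 : `|t| * (w * q) < q by rewrite mulrA gtr_pMl.
have h3 : - `|t| * z ^+ 2 <= t * z ^+ 2.
  by rewrite ler_wpM2r ?sqr_ge0 // lerNnormlW.
lra.
Qed.

Lemma det_add_rank1 n (S : 'M[R]_n) (u : 'cV[R]_n) (t : R) : S \in unitmx ->
  \det (S + t *: (u *m u^T)) = \det S * (1 + t * (u^T *m invmx S *m u) 0 0).
Proof.
move=> uS.
have -> : S + t *: (u *m u^T) = S *m (1%:M + (invmx S *m u) *m (t *: u^T)).
  by rewrite mulmxDr mulmx1 !mulmxA mulmxV // mul1mx -scalemxAr.
by rewrite det_mulmx det_add1_rank1 -scalemxAl mulmxA mxE.
Qed.

End RankOne.

(** * Stationarity of the optimum and its consequences for the inverse *)

Section Stationarity.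
Variable R : realType.

(** Applying [ln y <= y - 1] to the inverse of [1 + t * a] gives [t * (a - g) <= t ^+ 2 * (g * a)];
    small [t] of both signs then force [a = g], with no derivative taken. *)
Lemma ln_tangent (a g r : R) : 0 < r ->
  (forall t, `|t| < r -> 0 < 1 + t * a /\ ln (1 + t * a) <= t * g) -> a = g.
Proof.
move=> r0 h; apply/eqP; rewrite -subr_eq0; apply/negPn/negP => ag.
have key t : `|t| < r -> t * (a - g) <= t ^+ 2 * (g * a).
  move=> /h[p le_ln].
  have : ln (1 + t * a)^-1 <= (1 + t * a)^-1 - 1 by rewrite ln_le_sub1 ?invr_gt0.
  rewrite lnV ?posrE // => le_inv.
  have : (1 - t * g) * (1 + t * a) <= (1 + t * a)^-1 * (1 + t * a).
    by rewrite ler_wpM2r ?(ltW p) //; lra.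
  by rewrite mulVf ?gt_eqF //; lra.
have D0 : 0 < `|a - g| by rewrite normr_gt0.
(* The first bound keeps [s] below [r], the second makes [s * (g * a)] smaller than [|a - g|]; the
   [+ 1] keeps its denominator positive. *)
pose s := Num.min (r / 2) (`|a - g| / (2 * (`|g * a| + 1))).
have ga0 : 0 < `|g * a| + 1 by rewrite ltr_wpDl.
have s0 : 0 < s by rewrite lt_min !divr_gt0 // mulr_gt0.
have sr : s < r.
  have : s <= r / 2 by rewrite ge_min lexx.
  lra.
have sD : s * (2 * (`|g * a| + 1)) <= `|a - g|.
  by rewrite -ler_pdivlMr ?mulr_gt0 // ge_min lexx orbT.
have sga : s * (g * a) < `|a - g|.
  have : s * (g * a) <= s * `|g * a| by rewrite ler_wpM2l ?ler_norm // ltW.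
  have : 0 <= s * `|g * a| by rewrite mulr_ge0 // ltW.
  lra.
have k1 : a - g <= s * (g * a).
  have := key s; rewrite gtr0_norm // => /(_ sr).
  by rewrite expr2 -mulrA ler_pM2l.
have k2 : - (a - g) <= s * (g * a).
  have := key (- s); rewrite normrN gtr0_norm // => /(_ sr).
  by rewrite sqrrN expr2 -mulrA mulNr -mulrN ler_pM2l.
by move: sga; rewrite ltNge ler_norml; case/negP; lra.
Qed.

Lemma normrD_small (s t : R) : `|t| < `|s| -> `|s + t| = `|s| + Num.sg s * t.
Proof.
have [s0|s0|->] := ltrgt0P s; last by rewrite ltNge normr_ge0.
  rewrite gtr0_sg // mul1r ltr_norml => /andP[h1 h2]; rewrite gtr0_norm //; lra.
rewrite ltr0_sg // ltr_norml => /andP[h1 h2]; rewrite ltr0_norm; lra.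
Qed.

(** The gradient of the off-diagonal penalty at nonzero entries, with value 0 at zero entries. *)
Definition offdiag_sg n (S : 'M[R]_n) : 'M[R]_n :=
  \matrix_(i, j) if i != j then Num.sg (S i j) else 0.

(** No entry moved by [u *m u^T] changes sign, so the penalty is exactly affine in [t]; zero entries
    of [S] are not moved. *)
Lemma penalty_add_rank1 n (S : 'M[R]_n) (u : 'cV[R]_n) (t : R) :
  (forall i j, i != j -> u i 0 * u j 0 != 0 ->
     `|t * (u i 0 * u j 0)| < `|S i j|) ->
  \sum_(i < n) \sum_(j < n | i != j) `|(S + t *: (u *m u^T)) i j|
  = \sum_(i < n) \sum_(j < n | i != j) `|S i j|
    + t * (u^T *m offdiag_sg S *m u) 0 0.
Proof.
move=> small.
have -> : (u^T *m offdiag_sg S *m u) 0 0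
        = \sum_(i < n) \sum_(j < n | i != j) Num.sg (S i j) * (u i 0 * u j 0).
  rewrite -mulmxA mxE; apply: eq_bigr => i _.
  rewrite !mxE mulr_sumr [RHS]big_mkcond; apply: eq_bigr => j _.
  by rewrite mxE; case: ifP => _; ring.
rewrite mulr_sumr -big_split; apply: eq_bigr => i _ /=.
rewrite mulr_sumr -big_split; apply: eq_bigr => j ij /=.
have -> : (S + t *: (u *m u^T)) i j = S i j + t * (u i 0 * u j 0).
  by rewrite !mxE big_ord1 mxE.
have [->|uu] := eqVneq (u i 0 * u j 0) 0; first by rewrite !mulr0 !addr0.
by rewrite normrD_small ?small // mulrCA.
Qed.

(** Along [S + t *: (u *m u^T)] trace and penalty are affine in [t], and the log-determinant gains
    [ln (1 + t * a)]. Optimality bounds this logarithm by the affine gain, and [ln_tangent] equates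
    the slopes. *)
Lemma glasso_stationary n (Sigma S : 'M[R]_n) (lam r : R) (u : 'cV[R]_n) :
  glasso_opt Sigma lam S -> 0 < r ->
  (forall i j, i != j -> u i 0 * u j 0 != 0 ->
     r * `|u i 0 * u j 0| <= `|S i j|) ->
  (u^T *m invmx S *m u) 0 0
  = (u^T *m (Sigma + lam *: offdiag_sg S) *m u) 0 0.
Proof.
move=> [Spd Sopt] r0 small.
set a := (u^T *m invmx S *m u) 0 0.
have a0 : 0 <= a by apply: pd_quad_ge0; apply: pd_inv.
have a1 : 0 < a + 1 by rewrite ltr_wpDl.
(* The radius [r] preserves signs in [S]; [(a + 1)^-1] ensures [|t| * a < 1], also when [a = 0]. *)
apply: (@ln_tangent _ _ (Num.min r (a + 1)^-1)) => [|t].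
  by rewrite lt_min r0 invr_gt0.
rewrite lt_min => /andP[tr ta].
have ta1 : `|t| * a < 1.
  have : `|t| * (a + 1) < 1 by rewrite -ltr_pdivlMr // div1r.
  have := normr_ge0 t; lra.
have p : 0 < 1 + t * a.
  have : - `|t| * a <= t * a by rewrite ler_wpM2r // lerNnormlW.
  lra.
split=> //.
have := Sopt _ (pd_add_rank1 Spd ta1).
rewrite /glasso_obj penalty_add_rank1; last first.
  move=> i j ij uu; rewrite normrM (lt_le_trans _ (small i j ij uu)) //.
  by rewrite ltr_pM2r // normr_gt0.
rewrite det_add_rank1 ?pd_unitmx // -/a lnM ?posrE ?pd_det_gt0 //.
rewrite mulmxDr mxtraceD -scalemxAr mxtraceZ.
have -> : \tr (Sigma *m (u *m u^T)) = (u^T *m Sigma *m u) 0 0.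
  by rewrite mulmxA mxtrace_mulC mulmxA /mxtrace big_ord1.
rewrite [X in _ -> _ <= t * X](_ : _ = (u^T *m Sigma *m u) 0 0
  + lam * (u^T *m offdiag_sg S *m u) 0 0).
  by set P := \sum_(_ < n) _; lra.
by rewrite mulmxDr mulmxDl mxE -scalemxAr -scalemxAl [X in _ + X]mxE.
Qed.

Lemma quad_delta n (A : 'M[R]_n) k :
  ((delta_mx k 0 : 'cV_n)^T *m A *m delta_mx k (0 : 'I_1)) 0 0 = A k k.
Proof. by rewrite trmx_delta -rowE -colE !mxE. Qed.

Lemma quad_delta2 n (A : 'M[R]_n) k l (s : R) :
  let u : 'cV_n := delta_mx k 0 + s *: delta_mx l 0 in
  (u^T *m A *m u) 0 0 = A k k + s * (A k l + A l k) + s ^+ 2 * A l l.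
Proof.
move=> u; have -> : u^T = delta_mx 0 k + s *: delta_mx 0 l.
  by apply/matrixP => i j; rewrite !mxE !(andbC (i == 0)).
rewrite /u !(mulmxDl, mulmxDr) -!scalemxAl -!scalemxAr.
rewrite -!rowE -!colE !mxE; ring.
Qed.

(** The direction [e_k] moves no off-diagonal entry, and [e_k + e_l] moves only [S k l] and [S l k].
    Removing the diagonal terms from the second condition leaves twice the wanted equation, by
    symmetry. *)
Lemma glasso_kkt n (Sigma S : 'M[R]_n) (lam : R) : glasso_opt Sigma lam S ->
  Sigma^T = Sigma ->
  (forall k, invmx S k k = Sigma k k) /\
  (forall k l, k != l -> S k l != 0 ->
     invmx S k l = Sigma k l + lam * Num.sg (S k l)).
Proof.
move=> Sopt Sigma_sym; have Ssym := proj1 (proj1 Sopt).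
have diag k : invmx S k k = Sigma k k.
  have := @glasso_stationary _ _ _ _ 1 (delta_mx k 0) Sopt ltr01.
  rewrite !quad_delta !mxE eqxx mulr0 addr0; apply=> i j ij.
  rewrite !mxE !andbT -natrM mulnb; case: (eqVneq i k) ij => [->|]; last by rewrite eqxx.
  by rewrite eq_sym => /negPf->; rewrite eqxx.
split=> // k l kl Skl.
have Wsym : invmx S l k = invmx S k l by rewrite -[in LHS]Ssym -trmx_inv mxE.
have sym (A : 'M[R]_n) : A^T = A -> A l k = A k l by move=> As; rewrite -{1}As mxE.
have := @glasso_stationary _ _ _ _ `|S k l| (delta_mx k 0 + 1 *: delta_mx l 0) Sopt.
rewrite normr_gt0 !quad_delta2 !diag Wsym => /(_ Skl).
have SG x y : (Sigma + lam *: offdiag_sg S) x y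
    = Sigma x y + lam * (if x != y then Num.sg (S x y) else 0) by rewrite !mxE.
rewrite !SG !eqxx kl eq_sym kl (sym _ Ssym) (sym _ Sigma_sym) !mulr0.
rewrite expr1n !mul1r => stat.
suff /stat : forall i j, i != j ->
    (delta_mx k 0 + 1 *: delta_mx l 0 : 'cV[R]_n) i 0
    * (delta_mx k 0 + 1 *: delta_mx l 0 : 'cV[R]_n) j 0 != 0 ->
    `|S k l| * `|(delta_mx k 0 + 1 *: delta_mx l 0 : 'cV[R]_n) i 0
    * (delta_mx k 0 + 1 *: delta_mx l 0 : 'cV[R]_n) j 0| <= `|S i j|.
  by lra.
move=> i j ij; rewrite !mxE !andbT !mul1r.
have [ik|ik] := eqVneq i k; have [jk|jk] := eqVneq j k.
- by move: ij; rewrite ik jk eqxx.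
- rewrite ik (negPf kl); have [->|] := eqVneq j l.
    by rewrite addr0 add0r mulr1 normr1 mulr1.
  by rewrite !addr0 mulr0 eqxx.
- rewrite jk (negPf kl); have [->|] := eqVneq i l.
    by rewrite addr0 add0r mulr1 normr1 mulr1 (sym _ Ssym).
  by rewrite !addr0 mul0r eqxx.
- have [il|] := eqVneq i l; have [jl|] := eqVneq j l.
  + by move: ij; rewrite il jl eqxx.
  + by rewrite !addr0 mulr0 eqxx.
  + by rewrite !addr0 mul0r eqxx.
  + by rewrite !addr0 mul0r eqxx.
Qed.

(** The quadratic form at [e_k + e_l] and [e_k - e_l] is [2 + 2 A_kl] and [2 - 2 A_kl]. *)
Lemma pd_offdiag_lt1 n (A : 'M[R]_n) k l : pd A -> (forall i, A i i = 1) ->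
  k != l -> `|A k l| < 1.
Proof.
move=> Apd A1 kl; have Alk : A l k = A k l by rewrite -{1}(proj1 Apd) mxE.
have pos s : 0 < 1 + s * (A k l + A k l) + s ^+ 2.
  have := proj2 Apd (delta_mx k 0 + s *: delta_mx l 0).
  rewrite quad_delta2 !A1 Alk mulr1; apply.
  apply/eqP => /matrixP/(_ k 0)/eqP.
  by rewrite !mxE !eqxx (negPf kl) mulr0 addr0 oner_eq0.
have := pos 1; have := pos (- 1).
rewrite ltr_norml sqrrN expr1n; lra.
Qed.

Lemma glasso_completion n (Sigma S : 'M[R]_n) (lam : R) :
  correlation Sigma -> glasso_opt Sigma lam S ->
  (forall i j : 'I_n, i != j -> (S i j != 0 <-> lam < `|Sigma i j|)) ->
  1 / 2 <= lam -> completion Sigma lam (invmx S).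
Proof.
move=> [[Sigma_sym _] [Sigma1 _]] Sopt sparse lam_ge.
have [diag off] := glasso_kkt Sopt Sigma_sym.
have W1 i : invmx S i i = 1 by rewrite diag.
move=> i j; rewrite /in_pattern mxE; case: (eqVneq i j) => [-> _|ij /= eij].
  exact: W1.
have big : lam < `|Sigma i j| by case/andP: eij.
have Sij := proj2 (sparse i j ij) big.
have := pd_offdiag_lt1 (pd_inv (proj1 Sopt)) W1 ij.
rewrite eij (off _ _ ij Sij) ltr_norml.
(* Opposite signs of [S i j] and [Sigma i j] give the entry of [Cmat]; equal signs contradict the
   bound by 1, since [2 * lam >= 1]. *)
case: (sgrP (S i j)) Sij big => // _ _; case: (ltrgt0P (Sigma i j)) => // s0;
  rewrite ?(gtr0_sg s0) ?(ltr0_sg s0); lra.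
Qed.

Lemma glasso_unique_maxdet n (Sigma S : 'M[R]_n) (lam : R) :
  pd S -> (forall i j, ~~ in_pattern Sigma lam i j -> S i j = 0) ->
  completion Sigma lam (invmx S) -> unique_maxdet_completion Sigma lam (invmx S).
Proof.
move=> Spd S0 complW; split; [exact: pd_inv | split=> // Y Ypd complY YW].
have uS := pd_unitmx Spd.
have trE : \tr (S *m Y) = n%:R.
  rewrite -[RHS](mxtrace1 R n) -(mulmxV uS); apply: eq_bigr => i _.
  rewrite !mxE; apply: eq_bigr => j _.
  have [Sij|Sij] := eqVneq (S i j) 0; first by rewrite Sij !mul0r.
  have inE_ij : in_pattern Sigma lam i j.
    by apply: contraNT Sij => /S0->.
  (* The trace pairs [S i j] with entry [j i] of the other factor; symmetry moves it back to the
     pattern position [i j]. *)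
  have Ysym := proj1 Ypd; have Wsym := proj1 (pd_inv Spd).
  by rewrite -Ysym -Wsym !mxE complY // complW.
have SY1 : S *m Y != 1%:M.
  by apply: contra_neq YW => SY; rewrite -[Y](mulKmx uS) SY mulmx1.
have := pd_det_lt Spd Ypd trE SY1.
by rewrite det_inv lnV ?posrE ?pd_det_gt0 //; lra.
Qed.

End Stationarity.

(** * Explicit factors along a perfect elimination ordering *)

Section Elimination.
Variable R : realType.

(** Entry [i k] of [Y *m L^T] is [Y i k] plus terms containing [Y i j] with [j < k], so each row of
    [Y] is solved from left to right. *)
Lemma upper_of_mul_tr n (Y L : 'M[R]_n) : unit_lower L -> Y *m L^T = 1%:M ->
  (forall i, Y i i = 1) /\ (forall i k : 'I_n, (k < i)%N -> Y i k = 0).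
Proof.
move=> [L1 L0] YL.
have row_eq (i k : 'I_n) : (forall j : 'I_n, (j < k)%N -> Y i j = 0) ->
    Y i k = (i == k)%:R.
  move=> Y0; have := congr1 (fun M : 'M_n => M i k) YL; rewrite !mxE => <-.
  rewrite (bigD1 k) //= mxE L1 mulr1 big1 ?addr0 // => j jk.
  rewrite mxE; case: (ltngtP j k) => [/Y0->|/L0->|/val_inj jk']; rewrite ?mul0r ?mulr0 //.
  by rewrite jk' eqxx in jk.
have low (i k : 'I_n) : (k < i)%N -> Y i k = 0.
  have [m] := ubnP (k : nat); elim: m k => // m IH k km ki.
  rewrite row_eq; first by rewrite -val_eqE gtn_eqF.
  by move=> j jk; apply: IH; [apply: leq_trans jk _|apply: ltn_trans jk ki].
split=> // i; rewrite row_eq ?eqxx // => j; exact: low.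
Qed.

(* As [T^-1 (L D L^T) = 1], column [j] of [T^-1 L] vanishes below the diagonal
   and has diagonal entry [1 / D_j]; since [L] has no fill-in, these equations
   only involve entries of [T^-1] on the pattern. *)
Lemma peo_ldl_formula n (e : rel 'I_n) (C T : 'M[R]_n) :
  pd T -> peo e -> (forall i j, i != j -> ~~ e i j -> T i j = 0) ->
  (forall i j, (i == j) || e i j -> invmx T i j = C i j) ->
  T = Lmat e C *m Dmat e C *m (Lmat e C)^T.
Proof.
move=> Tpd pe T0 TC.
have [L [c [uL Ls cp TE]]] := pd_ldl_sparse Tpd pe T0.
have [L1 L0] := uL; have Xpd := pd_inv Tpd.
set X := invmx T in TC Xpd.
have Xsym i j : X i j = X j i by rewrite -{1}(proj1 Xpd) mxE.
have XT : (X *m L *m diag_mx c) *m L^T = 1%:M.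
  by rewrite -!mulmxA [L *m _]mulmxA -TE mulVmx ?pd_unitmx.
have [Ydiag Ylow] := upper_of_mul_tr uL XT.
have YE i j : (X *m L *m diag_mx c) i j = (X *m L) i j * c 0 j.
  by rewrite mul_mx_diag mxE.
have XLE i j : (X *m L) i j
    = X i j + \sum_(a < #|Iset e j|) X i (enum_val a) * L (enum_val a) j.
  rewrite mxE (bigD1 j) //= L1 mulr1; congr (_ + _).
  rewrite -(big_enum_val (fun k => X i k * L k j)) /=.
  rewrite big_mkcond [RHS]big_mkcond; apply: eq_bigr => k _; rewrite inE.
  case: (ltngtP k j) => [kj|kj|/val_inj->]; last by rewrite eqxx.
    by rewrite L0 // mulr0 if_same.
  rewrite -val_eqE gtn_eqF //=; case: ifPn => // ne.
  by rewrite Ls // mulr0.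
have mem j (a : 'I_#|Iset e j|) : (j < enum_val a)%N /\ e (enum_val a) j.
  by have := enum_valP a; rewrite inE => /andP.
have LcolE j a : Lcol e C j a 0 = L (enum_val a) j.
  rewrite /Lcol; set CII := \matrix_(a, b) _; set CIj := \col_a _.
  (* The set [Iset e j] is a clique, so [C] agrees with [X] on it, and a principal submatrix of [X]
     is invertible. *)
  have CIIE : CII = mxsub enum_val enum_val X.
    apply/matrixP => x y; rewrite !mxE TC //.
    have [->|xy] := eqVneq x y; first by rewrite eqxx.
    apply/orP; right; apply: (pe j); rewrite ?enum_valP //.
    by rewrite (inj_eq enum_val_inj).
  have uCII : CII \in unitmx.
    by rewrite CIIE; apply/pd_unitmx/pd_mxsub => //; apply: enum_val_inj.
  pose l : 'cV[R]_#|Iset e j| := \col_b L (enum_val b) j.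
  suff -> : CIj = - (CII *m l) by rewrite mulmxN opprK mulKmx // mxE.
  apply/matrixP => x y; have [jx ex] := mem j x.
  (* Row [enum_val x] lies below the diagonal; after cancelling the positive pivot, the vanishing
     entry of [X *m L] is one row of the system solved by [Lcol]. *)
  have := Ylow _ _ jx; rewrite YE => /eqP.
  rewrite mulf_eq0 (gt_eqF (cp j)) orbF XLE addr_eq0 => /eqP XE.
  rewrite !mxE -TC ?ex ?orbT // XE; congr (- _); apply: eq_bigr => b _.
  by rewrite CIIE !mxE.
have -> : Lmat e C = L.
  apply/matrixP => i j; rewrite mxE; have [->|ij] := eqVneq i j; first by rewrite L1.
  have [iI|iI] := boolP (i \in Iset e j).
    rewrite (bigD1 (enum_rank_in iI i)) /= ?enum_rankK_in // LcolE enum_rankK_in //.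
    rewrite big1 ?addr0 // => a /andP[/eqP ai /negP[]].
    by apply/eqP/enum_val_inj; rewrite enum_rankK_in.
  rewrite big1 => [|a /eqP ai]; last by rewrite -ai enum_valP in iI.
  move: iI; rewrite inE; case: (ltngtP i j) => [lt_ij _|ji /= ne|/val_inj ji].
  - by rewrite L0.
  - by rewrite Ls.
  - by rewrite ji eqxx in ij.
have -> // : Dmat e C = diag_mx c.
apply/matrixP => i j; rewrite !mxE; case: eqVneq => // [<-{j}].
(* The diagonal entry of [X *m L] times [c 0 i] is 1, so the pivot is its inverse. *)
rewrite mulr1n; have := Ydiag i; rewrite YE XLE => XE.
have -> : C i i + \sum_(a < #|Iset e i|) C (enum_val a) i * Lcol e C i a 0
        = X i i + \sum_(a < #|Iset e i|) X i (enum_val a) * L (enum_val a) i.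
  rewrite -TC ?eqxx //; congr (_ + _); apply: eq_bigr => a _.
  by rewrite LcolE Xsym TC // (proj2 (mem i a)) orbT.
rewrite -[LHS]mul1r -XE mulrAC mulfV ?mul1r //.
by apply: contraPneq XE => ->; rewrite mul0r => /esym/eqP; rewrite oner_eq0.
Qed.

Lemma relabel_inv n (p : 'S_n) (A : 'M[R]_n) : A \in unitmx ->
  invmx (relabel p A) = relabel p (invmx A).
Proof.
move=> uA; have AV : relabel p A *m relabel p (invmx A) = 1%:M.
  apply/matrixP => i j; rewrite !mxE -(inj_eq (@perm_inj _ p)).
  have <- : (A *m invmx A) (p i) (p j) = (p i == p j)%:R by rewrite mulmxV // mxE.
  rewrite mxE [RHS](reindex_inj (@perm_inj _ p)).
  by apply: eq_bigr => k _; rewrite !mxE.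
by have [uB _] := mulmx1_unit AV; rewrite -[RHS](mulKmx uB) AV mulmx1.
Qed.

Lemma pd_relabel n (p : 'S_n) (A : 'M[R]_n) : pd A -> pd (relabel p A).
Proof. by move=> Apd; apply: pd_mxsub Apd; apply: perm_inj. Qed.

Lemma gedge_relabel n (p : 'S_n) (Sigma : 'M[R]_n) lam i j :
  gedge (relabel p Sigma) lam i j = gedge Sigma lam (p i) (p j).
Proof. by rewrite /gedge mxE (inj_eq (@perm_inj _ p)). Qed.

End Elimination.

Theorem theorem3 (R : realType) (d : nat) (Sigma S : 'M[R]_d) (lam : R) :
  correlation Sigma -> 0 < lam ->
  glasso_opt Sigma lam S ->
  (forall i j : 'I_d, i != j -> (S i j != 0 <-> lam < `|Sigma i j|)) ->
  1 / 2 <= lam ->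
  unique_maxdet_completion Sigma lam (invmx S) /\
  (chordal (gedge Sigma lam) ->
   forall p : 'S_d,
     let e := gedge (relabel p Sigma) lam in
     let C := relabel p (Cmat Sigma lam) in
     peo e ->
     relabel p S = Lmat e C *m Dmat e C *m (Lmat e C)^T).
Proof.
move=> corr _ Sopt sparse lam_ge; have Spd := proj1 Sopt.
have compl := glasso_completion corr Sopt sparse lam_ge.
have S0 i j : ~~ in_pattern Sigma lam i j -> S i j = 0.
  rewrite negb_or negb_and => /andP[ij]; rewrite ij /= => nlt.
  by apply/eqP/negPn/negP => /(proj1 (sparse i j ij)); apply/negP.
split; first exact: glasso_unique_maxdet.
(* Positive definiteness, zero pattern and inverse all commute with relabeling, so the formula
   applies to [relabel p S]. *)
move=> _ p e C pe; apply: peo_ldl_formula => //; first exact: pd_relabel.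
- move=> i j ij; rewrite /e gedge_relabel => ne; rewrite mxE S0 //.
  by rewrite /in_pattern negb_or (inj_eq perm_inj) ij.
- move=> i j eij; rewrite relabel_inv ?pd_unitmx // !mxE compl ?mxE //.
  by rewrite /in_pattern (inj_eq perm_inj) -gedge_relabel.
Qed.
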